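(* Let $C_1$ be the one-point compactification assignment on $\mathcal{I}_1$. The assignment $G_D:\mathbf{DBunC^*Alg}_{C_1(\mathcal{I}_1)}\to\mathbf{DC^*Alg}$ given on objects by $$\left(\left(\mathfrak{A}_\hbar,\phi^{C_1(I)}_\hbar\right)_{\hbar\in C_1(I)},\mathfrak{A},(\tau^{\mathcal{A}}_t)_{t\in\mathbb{R}}\right)\mapsto\left(\mathfrak{A}_{0_I},(\tau^{\mathcal{A}}_{t;0_I})_{t\in\mathbb{R}}\right),\qquad \tau^{\mathcal{A}}_{t;0_I}\left(\phi^{C_1(I)}_{0_I}(a)\right):=\phi^{C_1(I)}_{0_I}(\tau^{\mathcal{A}}_t(a))\quad (a\in\mathfrak{A}),$$ and on morphisms by $\sigma\mapsto G(\sigma)$ is a functor.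
   Context: For a metric space $I$, $UC_b(I)$ is the C*-algebra of bounded uniformly continuous functions $I\to\mathbb{C}$. C*-algebras are not assumed unital. A $UC_b$ bundle of C*-algebras over a metric space $I$, written $((\mathfrak{A}_\hbar,\phi^I_\hbar)_{\hbar\in I},\mathfrak{A})$, is a family of C*-algebras $(\mathfrak{A}_\hbar)_{\hbar\in I}$, a C*-algebra $\mathfrak{A}$, and *-homomorphisms $\phi^I_\hbar:\mathfrak{A}\to\mathfrak{A}_\hbar$ such that: (i) each $\phi^I_\hbar$ is surjective and $\|a\|=\sup_{\hbar\in I}\|\phi^I_\hbar(a)\|_\hbar$ for all $a\in\mathfrak{A}$; (ii) for each $f\in UC_b(I)$ and $a\in\mathfrak{A}$ there is an element $fa\in\mathfrak{A}$ with $\phi^I_\hbar(fa)=f(\hbar)\phi^I_\hbar(a)$ for all $\hbar\in I$; (iii) for each $a\in\mathfrak{A}$, the function $\hbar\mapsto\|\phi^I_\hbar(a)\|_\hbar$ is in $UC_b(I)$. A homomorphism from $\mathcal{A}_I=((\mathfrak{A}_\hbar,\phi^I_\hbar)_{\hbar\in I},\mathfrak{A})$ to $\mathcal{B}_J=((\mathfrak{B}_\hbar,\phi^J_\hbar)_{\hbar\in J},\mathfrak{B})$ is a pair $\sigma=(\alpha,\beta)$ where $\alpha:I\to J$ is a metric map (i.e. $d_J(\alpha(x),\alpha(y))\le d_I(x,y)$), $\beta:\mathfrak{A}\to\mathfrak{B}$ is a *-homomorphism, and for all $a_1,a_2\in\mathfrak{A}$, $\hbar\in I$: if $\phi^I_\hbar(a_1)=\phi^I_\hbar(a_2)$,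 then $\phi^J_{\alpha(\hbar)}(\beta(a_1))=\phi^J_{\alpha(\hbar)}(\beta(a_2))$. Composition is componentwise. $\mathcal{I}_1$ is the collection of all locally compact, non-compact metric spaces $I$ whose one-point compactification $\dot I=I\cup\{0_I\}$ is metrizable by a metric for which the canonical embedding $\iota:I\to\dot I$ is isometric; $C_1(I):=\dot I$ with this metric, $\alpha_I:=\iota$, and $0_I$ is the unique point of $C_1(I)\setminus\alpha_I[I]$. For a proper metric map $\alpha:I\to J$ (proper: preimages of compact sets are compact), $C_1(\alpha):C_1(I)\to C_1(J)$ is its extension with $C_1(\alpha)(0_I)=0_J$. A dynamical bundle of C*-algebras over a base space $K$ is a $UC_b$ bundle $((\mathfrak{A}_\hbar,\phi^K_\hbar)_{\hbar\in K},\mathfrak{A})$ together with a one-parameter group of automorphisms $(\tau^{\mathcal{A}}_t)_{t\in\mathbb{R}}$ of $\mathfrak{A}$ such that for all $\hbar\in K$, $t\in\mathbb{R}$ there is an automorphism $\tau^{\mathcal{A}}_{t;\hbar}$ of $\mathfrak{A}_\hbar$ with $\tau^{\mathcal{A}}_{t;\hbar}\circ\phi^K_\hbar=\phi^K_\hbar\circ\tau^{\mathcal{A}}_t$. $\mathbf{DBunC^*Alg}_{C_1(\mathcal{I}_1)}$ has as objects the dynamical bundles over spaces $C_1(I)$, $I\in\mathcal{I}_1$, and as morphisms the bundle homomorphisms $\sigma=(C_1(\alpha),\beta)$, with $\alpha:I\to J$ a proper metric map, such that $\tau^{\mathcal{B}}_t\circ\beta=\beta\circ\tau^{\mathcal{A}}_t$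 for all $t\in\mathbb{R}$. For such $\sigma$, $G(\sigma)=\sigma_0:\mathfrak{A}_{0_I}\to\mathfrak{B}_{0_J}$ is given by $\sigma_0(\phi^{C_1(I)}_{0_I}(a)):=\phi^{C_1(J)}_{0_J}(\beta(a))$ for $a\in\mathfrak{A}$. $\mathbf{DC^*Alg}$ has as objects the pairs $(\mathfrak{A},(\tau^{\mathfrak{A}}_t)_{t\in\mathbb{R}})$ of a C*-algebra and a one-parameter group of automorphisms of it, and as morphisms the *-homomorphisms $\sigma_0:\mathfrak{A}\to\mathfrak{B}$ with $\tau^{\mathfrak{B}}_t\circ\sigma_0=\sigma_0\circ\tau^{\mathfrak{A}}_t$ for all $t\in\mathbb{R}$. *)

(* Defs.v *)
From HB Require Import structures.
From mathcomp Require Import all_boot all_order all_algebra.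
From mathcomp Require Import complex.
From mathcomp Require Import all_classical all_reals.
From mathcomp Require Import topology normedtype.

Set Implicit Arguments.
Unset Strict Implicit.
Unset Printing Implicit Defensive.

Import Order.TTheory GRing.Theory Num.Theory.
Import numFieldNormedType.Exports.

Local Open Scope classical_set_scope.
Local Open Scope ring_scope.
Local Open Scope complex_scope.

(** * C*-algebras *)

(** C*-algebras are not assumed unital, so the product is not the one of a
    MathComp ring.  The norm [`|x|] of a normed module over [R[i]] is a
    nonnegative, hence real, element of [R[i]]. *)
HB.mixin Record isCStarAlgebra (R : realType) A
    & CompleteNormedModule R[i] A := {
  cmul : A -> A -> A;
  cadj : A -> A;
  cmulA : associative cmul;
  cmulDl : left_distributive cmul +%R;
  cmulDr : right_distributive cmul +%R;
  cmulZl : forall (z : R[i]) (x y : A), cmul (z *: x) y = z *: cmul x y;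
  cmulZr : forall (z : R[i]) (x y : A), cmul x (z *: y) = z *: cmul x y;
  cmul_norm : forall x y : A, `|cmul x y| <= `|x| * `|y|;
  cadjK : involutive cadj;
  cadjD : {morph cadj : x y / x + y};
  cadjZ : forall (z : R[i]) (x : A), cadj (z *: x) = z^* *: cadj x;
  cadjM : forall x y : A, cadj (cmul x y) = cmul (cadj y) (cadj x);
  cstar_norm : forall x : A, `|cmul (cadj x) x| = `|x| ^+ 2
}.

#[short(type="cstarAlgType")]
HB.structure Definition CStarAlgebra (R : realType) :=
  { A of CompleteNormedModule R[i] A & isCStarAlgebra R A }.

Definition cnorm (R : realType) (A : cstarAlgType R) (x : A) : R :=
  complex.Re `|x|.

Record starhom (R : realType) (A B : cstarAlgType R) := StarHom {
  starhom_fun :> A -> B;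
  starhom_linear : linear starhom_fun;
  starhom_mul : {morph starhom_fun : x y / cmul x y};
  starhom_adj : {morph starhom_fun : x / cadj x}
}.

Lemma starhom_eq (R : realType) (A B : cstarAlgType R) (f g : starhom A B) :
  f =1 g -> f = g.
Proof.
case: f g => [f f1 f2 f3] [g g1 g2 g3] /= /funext fg; case: _ / fg in g1 g2 g3 *.
by congr StarHom; exact: Prop_irrelevance.
Qed.

Definition starhom_id (R : realType) (A : cstarAlgType R) : starhom A A.
Proof. by exists id. Defined.

Definition starhom_comp (R : realType) (A B C : cstarAlgType R)
  (g : starhom B C) (f : starhom A B) : starhom A C.
Proof.
exists (g \o f) => [z x y|x y|x] /=.
- by rewrite !starhom_linear.
- by rewrite !starhom_mul.
- by rewrite !starhom_adj.
Defined.

(** No continuity in [t] is required. *)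
Record one_param_group (R : realType) (A : cstarAlgType R) := OneParamGroup {
  opg_fun :> R -> starhom A A;
  opg_bij : forall t, bijective (opg_fun t);
  opg0 : opg_fun 0 =1 id;
  opgD : forall s t, opg_fun (s + t) =1 opg_fun s \o opg_fun t
}.

(** * Bundles of C*-algebras *)

Definition UCb (R : realType) (I : metricType R) (f : I -> R[i]) : Prop :=
  (exists M : R, forall x, `|f x| <= M%:C) /\
  unif_continuous (f : I -> R[i]^o).

(** In [ucb_norm], the set whose [sup] is taken is bounded, by
    [ucb_norm_UCb]. *)
Record UCb_bundle (R : realType) (I : metricType R) := UCbBundle {
  fiber : I -> cstarAlgType R;
  total_alg : cstarAlgType R;
  proj : forall h : I, starhom total_alg (fiber h);
  ucb_surj : forall (h : I) (y : fiber h), exists a, proj h a = y;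
  ucb_norm : forall a, cnorm a = sup [set cnorm (proj h a) | h in [set: I]];
  ucb_scale : forall (f : I -> R[i]) (a : total_alg), UCb f ->
    exists fa : total_alg, forall h, proj h fa = f h *: proj h a;
  ucb_norm_UCb : forall a, UCb (fun h : I => (cnorm (proj h a))%:C)
}.

Definition metric_map (R : realType) (I J : metricType R) (f : I -> J) : Prop :=
  forall x y, mdist (f x) (f y) <= mdist x y.

Record bundle_hom (R : realType) (I J : metricType R)
    (A : UCb_bundle I) (B : UCb_bundle J) := BundleHom {
  bh_base : I -> J;
  bh_total : starhom (total_alg A) (total_alg B);
  bh_metric : metric_map bh_base;
  bh_compat : forall (a1 a2 : total_alg A) (h : I), proj A h a1 = proj A h a2 ->
    proj B (bh_base h) (bh_total a1) = proj B (bh_base h) (bh_total a2)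
}.

Lemma bundle_hom_eq (R : realType) (I J : metricType R)
    (A : UCb_bundle I) (B : UCb_bundle J) (f g : bundle_hom A B) :
  bh_base f =1 bh_base g -> bh_total f =1 bh_total g -> f = g.
Proof.
case: f g => [f1 f2 f3 f4] [g1 g2 g3 g4] /= /funext e1 /starhom_eq e2.
case: _ / e1 in g3 g4 *; case: _ / e2 in g4 *.
by congr BundleHom; exact: Prop_irrelevance.
Qed.

Definition bundle_hom_id (R : realType) (I : metricType R) (A : UCb_bundle I) :
  bundle_hom A A.
Proof. by exists id (starhom_id (total_alg A)). Defined.

Definition bundle_hom_comp (R : realType) (I J K : metricType R)
  (A : UCb_bundle I) (B : UCb_bundle J) (C : UCb_bundle K)
  (g : bundle_hom B C) (f : bundle_hom A B) : bundle_hom A C.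
Proof.
exists (bh_base g \o bh_base f) (starhom_comp (bh_total g) (bh_total f)).
- by move=> x y /=; exact: le_trans (bh_metric g _ _) (bh_metric f _ _).
- by move=> a1 a2 h /(bh_compat f)/(bh_compat g).
Defined.

Record dyn_bundle (R : realType) (K : metricType R) := DynBundle {
  db_bundle :> UCb_bundle K;
  db_dyn : one_param_group (total_alg db_bundle);
  db_fiber : forall (h : K) (t : R),
    exists th : starhom (fiber db_bundle h) (fiber db_bundle h),
      bijective th /\
      forall a, th (proj db_bundle h a) = proj db_bundle h (db_dyn t a)
}.

(** * One-point compactification of metric spaces *)

(** [d] is a metric on the one-point compactification of [I], inducing its
    topology and making the embedding [Some] isometric. *)
Record opc_metric (R : realType) (I : metricType R)
    (d : one_point_compactification I -> one_point_compactification I -> R) :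
    Prop := {
  opcm_xx : forall p, d p p = 0;
  opcm_eq : forall p q, d p q = 0 -> p = q;
  opcm_sym : forall p q, d p q = d q p;
  opcm_triangle : forall q p r, d p r <= d p q + d q r;
  opcm_nbhs : forall p U,
    nbhs p U <-> exists2 e : R, 0 < e & [set q | d p q < e] `<=` U;
  opcm_isometric : forall x y : I, d (Some x) (Some y) = mdist x y
}.

Record I1 (R : realType) := MkI1 {
  I1_space :> metricType R;
  I1_locally_compact : locally_compact [set: I1_space];
  I1_noncompact : ~ compact [set: I1_space];
  I1_metrizable : exists d, @opc_metric R I1_space d
}.

Definition C1 (R : realType) (I : I1 R) : Type := one_point_compactification I.

(** Since [I] is not compact, it is dense in its one-point compactification, so
    that there is only one such metric. *)
Definition C1_dist (R : realType) (I : I1 R) : C1 I -> C1 I -> R :=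
  projT1 (cid (I1_metrizable I)).

Lemma C1_distP (R : realType) (I : I1 R) : opc_metric (@C1_dist R I).
Proof. exact: projT2 (cid (I1_metrizable I)). Qed.

HB.instance Definition _ (R : realType) (I : I1 R) := Choice.on (C1 I).
HB.instance Definition _ (R : realType) (I : I1 R) :=
  @isMetric.Build R (C1 I) (@C1_dist R I) (opcm_xx (C1_distP I))
    (opcm_eq (C1_distP I)) (opcm_sym (C1_distP I)) (opcm_triangle (C1_distP I)).

Definition C1_embed (R : realType) (I : I1 R) (x : I) : C1 I := Some x.
Definition C1_zero (R : realType) (I : I1 R) : C1 I := None.

Definition C1_map (R : realType) (I J : I1 R) (f : I -> J) (p : C1 I) : C1 J :=
  if p is Some x then C1_embed (f x) else C1_zero J.

Definition proper_map (X Y : topologicalType) (f : X -> Y) : Prop :=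
  forall K : set Y, compact K -> compact (f @^-1` K).

(** * Categories and functors *)

Record category := Category {
  obj : Type;
  hom : obj -> obj -> Type;
  idm : forall A, hom A A;
  compm : forall A B C, hom B C -> hom A B -> hom A C;
  compm_idl : forall A B (f : hom A B), compm (idm B) f = f;
  compm_idr : forall A B (f : hom A B), compm f (idm A) = f;
  compmA : forall A B C D (h : hom C D) (g : hom B C) (f : hom A B),
    compm h (compm g f) = compm (compm h g) f
}.

Definition is_functor (C D : category) (Fobj : obj C -> obj D)
    (Fhom : forall A B : obj C, hom A B -> hom (Fobj A) (Fobj B)) : Prop :=
  (forall A, Fhom A A (idm A) = idm (Fobj A)) /\
  (forall A B E (g : hom B E) (f : hom A B),
    Fhom A E (compm g f) = compm (Fhom B E g) (Fhom A B f)).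

(** * The category of C*-algebras with dynamics *)

Record dcstar (R : realType) := DCStar {
  dc_alg : cstarAlgType R;
  dc_dyn : one_param_group dc_alg
}.

Record dcstar_hom (R : realType) (A B : dcstar R) := DCStarHom {
  dch_hom :> starhom (dc_alg A) (dc_alg B);
  dch_dyn : forall t a, dc_dyn B t (dch_hom a) = dch_hom (dc_dyn A t a)
}.

Lemma dcstar_hom_eq (R : realType) (A B : dcstar R) (f g : dcstar_hom A B) :
  f =1 g -> f = g.
Proof.
case: f g => [f f1] [g g1] /= /starhom_eq fg; case: _ / fg in g1 *.
by congr DCStarHom; exact: Prop_irrelevance.
Qed.

Definition dcstar_id (R : realType) (A : dcstar R) : dcstar_hom A A.
Proof. by exists (starhom_id (dc_alg A)). Defined.

Definition dcstar_comp (R : realType) (A B C : dcstar R)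
  (g : dcstar_hom B C) (f : dcstar_hom A B) : dcstar_hom A C.
Proof.
by exists (starhom_comp g f) => t a /=; rewrite !dch_dyn.
Defined.

Definition DCStarCat (R : realType) : category.
Proof.
exists (dcstar R) (@dcstar_hom R) (@dcstar_id R) (@dcstar_comp R);
  by move=> *; apply: dcstar_hom_eq.
Defined.

(** * The category of dynamical bundles over the spaces [C1 I] *)

Record dbun (R : realType) := DBun {
  dbun_base : I1 R;
  dbun_bundle :> dyn_bundle (C1 dbun_base)
}.

Record dbun_hom (R : realType) (A B : dbun R) := DBunHom {
  dbh_hom :> bundle_hom A B;
  dbh_base : exists f : dbun_base A -> dbun_base B,
    [/\ metric_map f, proper_map f & bh_base dbh_hom = C1_map f];
  dbh_dyn : forall t a,
    db_dyn B t (bh_total dbh_hom a) = bh_total dbh_hom (db_dyn A t a)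
}.

Lemma dbun_hom_eq (R : realType) (A B : dbun R) (f g : dbun_hom A B) :
  bh_base f =1 bh_base g -> bh_total f =1 bh_total g -> f = g.
Proof.
case: f g => [f f1 f2] [g g1 g2] /= e1 /(bundle_hom_eq e1) fg.
case: _ / fg in g1 g2 *.
by congr DBunHom; exact: Prop_irrelevance.
Qed.

Definition dbun_id (R : realType) (A : dbun R) : dbun_hom A A.
Proof.
exists (bundle_hom_id A) => //.
by exists id; split => //=; apply/funext => -[].
Defined.

Definition dbun_comp (R : realType) (A B C : dbun R)
  (g : dbun_hom B C) (f : dbun_hom A B) : dbun_hom A C.
Proof.
exists (bundle_hom_comp g f) => [|t a] /=; last by rewrite !dbh_dyn.
case: (dbh_base g) (dbh_base f) => [v [mv pv ->]] [u [mu pu ->]].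
exists (v \o u); split; last by apply/funext => -[].
- by move=> x y /=; exact: le_trans (mv _ _) (mu _ _).
- by move=> K /pv/pu.
Defined.

Definition DBunC1Cat (R : realType) : category.
Proof.
exists (dbun R) (@dbun_hom R) (@dbun_id R) (@dbun_comp R);
  by move=> *; apply: dbun_hom_eq.
Defined.

(** * The assignment on objects and morphisms *)

Definition fiber0 (R : realType) (A : dbun R) : cstarAlgType R :=
  fiber A (C1_zero (dbun_base A)).

Definition proj0 (R : realType) (A : dbun R) : starhom (total_alg A) (fiber0 A) :=
  proj A (C1_zero (dbun_base A)).

Definition GD_dyn (R : realType)
    (tau0 : forall A : dbun R, one_param_group (fiber0 A)) : Prop :=
  forall (A : dbun R) (t : R) (a : total_alg A),
    tau0 A t (proj0 A a) = proj0 A (db_dyn A t a).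

Definition GD_obj (R : realType)
    (tau0 : forall A : dbun R, one_param_group (fiber0 A))
    (A : dbun R) : dcstar R :=
  DCStar (tau0 A).

Definition GD_hom (R : realType)
    (tau0 : forall A : dbun R, one_param_group (fiber0 A))
    (G : forall A B : dbun R,
      dbun_hom A B -> dcstar_hom (GD_obj tau0 A) (GD_obj tau0 B)) : Prop :=
  forall (A B : dbun R) (sigma : dbun_hom A B) (a : total_alg A),
    G A B sigma (proj0 A a) = proj0 B (bh_total sigma a).

(* Main.v *)
Require Import Defs.
From mathcomp Require Import all_boot all_order all_algebra.
From mathcomp Require Import all_classical all_reals.
From mathcomp Require Import metric_structure.

(** Every fibre projection [proj A h] is surjective, so a map out of the fibre
    [fiber0 A] at infinity is determined by its composite with [proj0 A], and
    a *-homomorphism out of [total_alg A] descends to [fiber0 A] as soon as it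
    identifies the elements that [proj0 A] identifies ([starhom_factor]).  This
    gives everything.

    The maps [db_dyn A t] descend because each of them is intertwined by
    [proj0 A] with some automorphism of the fibre; these automorphisms inherit
    the group law from [db_dyn A] by surjectivity ([fiber_dyn]).  The total map
    of a morphism of bundles descends because the base map, being an extension
    [C1_map f], sends the point at infinity to the point at infinity, where the
    compatibility condition of a bundle homomorphism is just the required one
    ([proj0_compat]).  Uniqueness, equivariance of the induced homomorphism and
    functoriality are equations between maps on [fiber0 A] which hold after
    composition with [proj0 A], hence hold. *)

Set Implicit Arguments.
Unset Strict Implicit.
Unset Printing Implicit Defensive.

Import GRing.Theory.
(* [proj] is to denote the projections of a bundle. *)
Import Defs.
Local Open Scope ring_scope.

(** The factorization is [q] composed with any set-theoretic section of [p]: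
    it does not depend on the section, so every operation can be computed on
    preimages under [p]. *)
Lemma starhom_factor (R : realType) (A B C : cstarAlgType R)
    (p : starhom A B) (q : starhom A C) :
  (forall y, exists a, p a = y) ->
  (forall a1 a2, p a1 = p a2 -> q a1 = q a2) ->
  exists r : starhom B C, forall a, r (p a) = q a.
Proof.
move=> p_surj pq; have [s sK] := choice p_surj.
have qs a : q (s (p a)) = q a by apply: pq.
have lin : linear (q \o s).
  move=> z x y; rewrite -(sK x) -(sK y) -starhom_linear /= !qs.
  exact: starhom_linear.
have mul : {morph q \o s : x y / cmul x y}.
  move=> x y; rewrite -(sK x) -(sK y) -starhom_mul /= !qs.
  exact: starhom_mul.
have adj : {morph q \o s : x / cadj x}.
  by move=> x; rewrite -(sK x) -starhom_adj /= !qs; exact: starhom_adj.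
by exists (StarHom lin mul adj).
Qed.

Lemma one_param_group_eq (R : realType) (A : cstarAlgType R)
    (f g : one_param_group A) : (forall t, f t =1 g t) -> f = g.
Proof.
case: f g => [f f1 f2 f3] [g g1 g2 g3] /= fg.
have {}fg : f = g by apply/funext => t; apply: starhom_eq.
case: _ / fg in g1 g2 g3 *.
by congr OneParamGroup; exact: Prop_irrelevance.
Qed.

(** A dynamical bundle only provides one automorphism of the fibre for each time,
    with no relation between different times; surjectivity of [proj A h] makes
    each of them unique and hence turns the family into a one-parameter
    group. *)
Lemma fiber_dyn (R : realType) (K : metricType R) (A : dyn_bundle K) (h : K) :
  exists tau : one_param_group (fiber A h),
    forall t a, tau t (proj A h a) = proj A h (db_dyn A t a).
Proof.
have [tau tauP] := choice (db_fiber A h).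
have tauE t a : tau t (proj A h a) = proj A h (db_dyn A t a).
  by have [_] := tauP t.
have tau_bij t : bijective (tau t) by have [] := tauP t.
have tau0 : tau 0 =1 id.
  by move=> y; have [a <-] := ucb_surj y; rewrite tauE opg0.
have tauD s t : tau (s + t) =1 tau s \o tau t.
  by move=> y; have [a <-] := ucb_surj y; rewrite /= !tauE opgD.
by exists (OneParamGroup tau_bij tau0 tauD).
Qed.

Lemma proj0_surj (R : realType) (A : dbun R) (y : fiber0 A) :
  exists a, proj0 A a = y.
Proof. exact: ucb_surj. Qed.

(** This is what the special form [C1_map f] of the base map is for: for an
    arbitrary base map, the total map induces a homomorphism into the fibre of
    [B] over the image of infinity, which could be a point of the original
    space. *)
Lemma dbh_base_zero (R : realType) (A B : dbun R) (sigma : dbun_hom A B) :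
  bh_base sigma (C1_zero (dbun_base A)) = C1_zero (dbun_base B).
Proof. by have [f [_ _ ->]] := dbh_base sigma. Qed.

Lemma proj0_compat (R : realType) (A B : dbun R) (sigma : dbun_hom A B)
    (a1 a2 : total_alg A) :
  proj0 A a1 = proj0 A a2 ->
  proj0 B (bh_total sigma a1) = proj0 B (bh_total sigma a2).
Proof. by move/(bh_compat sigma); rewrite dbh_base_zero. Qed.

(** The equivariance of the induced homomorphism comes for free from that of
    the total map, for whatever fibre dynamics [tau0] is intertwined by the
    projections. *)
Lemma GD_hom_exists (R : realType)
    (tau0 : forall A : dbun R, one_param_group (fiber0 A))
    (A B : dbun R) (sigma : dbun_hom A B) : GD_dyn tau0 ->
  exists g : dcstar_hom (GD_obj tau0 A) (GD_obj tau0 B),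
    forall a, g (proj0 A a) = proj0 B (bh_total sigma a).
Proof.
move=> tau0E.
have [g gE] := starhom_factor (q := starhom_comp (proj0 B) (bh_total sigma))
  (@proj0_surj R A) (@proj0_compat R A B sigma).
have g_dyn t y : dc_dyn (GD_obj tau0 B) t (g y)
               = g (dc_dyn (GD_obj tau0 A) t y).
  have [a <-] := proj0_surj y.
  by rewrite /= tau0E !gE /= tau0E dbh_dyn.
by exists (@DCStarHom R (GD_obj tau0 A) (GD_obj tau0 B) g g_dyn).
Qed.

Theorem proposition5p4 (R : realType) :
  exists tau0 : forall A : dbun R, one_param_group (fiber0 A),
    unique (@GD_dyn R) tau0 /\
    exists G : forall A B : dbun R,
        dbun_hom A B -> dcstar_hom (GD_obj tau0 A) (GD_obj tau0 B),
      unique (@GD_hom R tau0) G /\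
      @is_functor (DBunC1Cat R) (DCStarCat R) (@GD_obj R tau0) G.
Proof.
pose tau0 (A : dbun R) : one_param_group (fiber0 A) :=
  projT1 (cid (fiber_dyn A (C1_zero (dbun_base A)))).
have tau0E : GD_dyn tau0.
  by move=> A; exact: projT2 (cid (fiber_dyn A (C1_zero (dbun_base A)))).
exists tau0; split.
  split=> // tau1 tau1E; apply: functional_extensionality_dep => A.
  apply: one_param_group_eq => t y; have [a <-] := proj0_surj y.
  by rewrite tau0E tau1E.
pose G A B sigma := projT1 (cid (@GD_hom_exists R tau0 A B sigma tau0E)).
have GE : GD_hom G.
  by move=> A B sigma; exact: projT2 (cid (GD_hom_exists sigma tau0E)).
exists G; split.
  split=> // G' G'E; apply: functional_extensionality_dep => A.
  apply: functional_extensionality_dep => B; apply/funext => sigma.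
  apply: dcstar_hom_eq => y; have [a <-] := proj0_surj y.
  by rewrite GE G'E.
split=> [A|A B E g f]; apply: dcstar_hom_eq => y; have [a <-] := proj0_surj y.
- by rewrite GE.
- by rewrite /= !GE.
Qed.
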